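(* Let $N=pd$ with $p,d$ positive integers, let $q_1,\dots,q_K$ be all the positive divisors of $N$, and suppose that $\mathcal R_{p,N}$ is a tight frame for $\ell^2(\mathbb Z_N)$ with bound $A$. Let $x\in\ell^2(\mathbb Z_N)$ be a signal supported on a set $\mathcal C\subseteq\mathbb Z_N$, and let $\mathcal J\subset\{0,\dots,d-1\}\times\{1,\dots,K\}$ be such that the samples $\{(x*c_{q_i})(pk):(k,i)\in\mathcal J^c\}$ are lost or unavailable, where $\mathcal J^c$ is the complement of $\mathcal J$ in $\{0,\dots,d-1\}\times\{1,\dots,K\}$. Let $$\mathcal T_{\mathcal J}x:=\frac1A\sum_{(k,i)\in\mathcal J}(x*c_{q_i})(pk)\,L_{pk}c_{q_i}.$$ If $$2\,\#\mathcal J^c\,\#\mathcal C<p\left(\frac{d}{\phi(N)}\right)^2,$$ then $x$ can be uniquely recovered from $\mathcal T_{\mathcal J}x$.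
   Context: $\ell^2(\mathbb Z_N)$ is the $N$-dimensional complex Hilbert space of functions on $\mathbb Z_N=\{0,1,\dots,N-1\}$ (identified with $N$-periodic functions on $\mathbb Z$), with $\langle x,y\rangle=\sum_{n=0}^{N-1}x(n)\overline{y(n)}$. For $m\in\mathbb Z$, the circular shift is $L_mx(n)=x(n-m)$. For a positive integer $q$, the $q$-th Ramanujan sum is $c_q(n)=\sum_{1\le k\le q,\,(k,q)=1}e^{2\pi i kn/q}$; it is $q$-periodic, so for $q\mid N$ it is regarded as an element of $\ell^2(\mathbb Z_N)$. $\phi$ is Euler's totient function. The circular convolution is $(x*y)(n)=\sum_{m=0}^{N-1}x(m)y(n-m)$. $\mathcal R_{p,N}$ denotes the family $(L_{pk}c_{q_i})$ indexed by $(k,i)\in\{0,\dots,d-1\}\times\{1,\dots,K\}$. A finite family $(f_j)$ is a tight frame for $\ell^2(\mathbb Z_N)$ with bound $A>0$ if $\sum_j|\langle x,f_j\rangle|^2=A\|x\|^2$ for all $x\in\ell^2(\mathbb Z_N)$. ''Supported on $\mathcal C$'' means $x(n)=0$ for $n\notin\mathcal C$; $\#$ denotes cardinality. *)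

(* Defs.v *)
From mathcomp Require Import all_boot all_order all_algebra.
From mathcomp Require Import complex.
From mathcomp Require Import reals trigo.

Set Implicit Arguments.
Unset Strict Implicit.
Unset Printing Implicit Defensive.

Import GRing.Theory Num.Theory.

#[local] Open Scope ring_scope.
#[local] Open Scope complex_scope.

(* Z_N for N > 0, as an additive group: unlike 'Z_N it has N elements also
   when N = 1, and unlike 'I_N it carries the arithmetic of residues. *)
Notation Zmod N := 'I_N.-1.+1.

Notation signal R N := {ffun Zmod N -> R[i]}.

Section Signals.
Variables (R : realType) (N : nat).
Implicit Types x y : signal R N.

Definition inner x y : R[i] := \sum_n x n * (y n)^*.

Definition shift (m : Zmod N) x : signal R N := [ffun n => x (n - m)].

Definition conv x y : signal R N := [ffun n => \sum_m x m * y (n - m)].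

Definition supported_on (C : {set Zmod N}) x : Prop :=
  forall n, n \notin C -> x n = 0.

Definition tight_frame (I : finType) (f : I -> signal R N) (A : R) : Prop :=
  0 < A /\ forall x, \sum_j `|inner x (f j)| ^+ 2 = A%:C * inner x x.

End Signals.

Definition expi (R : realType) (t : R) : R[i] := cos t +i* sin t.

Definition ramanujan_sum (R : realType) (q : nat) (n : int) : R[i] :=
  \sum_(1 <= k < q.+1 | coprime k q) expi (2 * pi * k%:R * n%:~R / q%:R : R).

(* Values are taken at the representatives 0, ..., N - 1; since the Ramanujan
   sum is q-periodic, the choice of representatives is immaterial if q %| N. *)
Definition ramanujan_signal (R : realType) (N q : nat) : signal R N :=
  [ffun n : Zmod N => ramanujan_sum R q (n : nat)%:Z].

Definition enumerates_divisors (N K : nat) (q : 'I_K -> nat) : Prop :=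
  injective q /\
  forall m : nat, (0 < m)%N && (m %| N)%N <-> exists i, q i = m.

Definition ramanujan_family (R : realType) (N p d K : nat) (q : 'I_K -> nat)
    (ki : 'I_d * 'I_K) : signal R N :=
  shift (inZp (p * ki.1)) (ramanujan_signal R N (q ki.2)).

Definition partial_reconstruction (R : realType) (N p d K : nat)
    (q : 'I_K -> nat) (A : R) (J : {set 'I_d * 'I_K}) (x : signal R N) :
    signal R N :=
  [ffun n => A%:C^-1 *
     \sum_(ki in J) conv x (ramanujan_signal R N (q ki.2)) (inZp (p * ki.1))
                    * ramanujan_family R N p q ki n].

(* Only the size of the support is bounded: C is not fixed in advance. *)
Definition sparse (R : realType) (N s : nat) (x : signal R N) : Prop :=
  exists C : {set Zmod N}, (#|C| <= s)%N /\ supported_on C x.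

(* x is the only element of the class S that is compatible with the data T x. *)
Definition uniquely_recoverable (X Y : Type) (T : X -> Y) (S : X -> Prop)
    (x : X) : Prop :=
  unique (fun y => S y /\ T y = T x) x.

(* Main.v *)
(* If y agrees with the data of x, then z = x - y has at most 2 #C nonzero
   values, and <T_J z, z> = 0 shows that z is orthogonal to every frame element
   indexed by J.  The frame identity then reduces to A |z|^2 = sum over J^c of
   |<z, f_j>|^2, where |<z, f_j>|^2 <= phi(N)^2 |z|_1^2 <= 2 #C phi(N)^2 |z|^2.
   Testing the frame identity on the constant signal 1, and keeping only the
   d translates of c_1 = 1, yields A >= N d = p d^2, hence z = 0. *)
Require Import Defs.
From mathcomp Require Import all_boot all_order all_algebra.
From mathcomp Require Import complex reals trigo.

Set Implicit Arguments.
Unset Strict Implicit.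
Unset Printing Implicit Defensive.

Import Order.TTheory GRing.Theory Num.Theory.

Local Open Scope ring_scope.

(** By Euler's product, each prime of [m] contributes at most what it contributes for [n], since its
    exponent can only grow. *)
Lemma totient_dvd_leq (m n : nat) :
  (0 < n)%N -> (m %| n)%N -> (totient m <= totient n)%N.
Proof.
move=> n_gt0 m_dv_n; have m_gt0 := dvdn_gt0 n_gt0 m_dv_n.
have sub_mn p : p \in primes m -> p \in primes n.
  rewrite !mem_primes => /and3P[p_pr _ p_dv_m].
  by rewrite p_pr n_gt0 (dvdn_trans p_dv_m).
rewrite !totientE //.
have /(perm_big _) -> /= :
    perm_eq (primes m) [seq p <- primes n | p \in primes m].
  rewrite uniq_perm ?filter_uniq ?primes_uniq // => p.
  by rewrite mem_filter; case: (boolP (p \in primes m)) => // /sub_mn ->.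
(* Both products now run over the primes of [n]; those not dividing [m] get the factor 1 on the
   left. *)
rewrite big_filter big_mkcond /= big_seq [leqRHS]big_seq.
apply: leq_prod => p; rewrite mem_primes => /and3P[p_pr _ _].
have p1_gt0 : (0 < p.-1)%N by rewrite -subn1 subn_gt0 prime_gt1.
case: ifP => _; last by rewrite muln_gt0 p1_gt0 expn_gt0 prime_gt0.
rewrite leq_pmul2l // leq_pexp2l ?prime_gt0 //.
by rewrite -!subn1 leq_sub2r // dvdn_leq_log.
Qed.

(** Cauchy-Schwarz against the constant 1, by summing [2 * f i * f j <= f i ^+ 2 + f j ^+ 2] over
    all pairs. Nonnegativity makes the values real, so this applies to moduli in [R[i]]. *)
Lemma sqr_sum_le_card (F : numDomainType) (I : finType) (D : {set I})
    (f : I -> F) :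
  (forall i, 0 <= f i) ->
  (\sum_(i in D) f i) ^+ 2 <= #|D|%:R * \sum_(i in D) f i ^+ 2.
Proof.
move=> f_ge0; rewrite -(ler_pM2l (ltr0Sn F 1)).
have <- : \sum_(i in D) \sum_(j in D) (f i ^+ 2 + f j ^+ 2)
        = 2%:R * (#|D|%:R * \sum_(i in D) f i ^+ 2).
  under eq_bigr => i _ do rewrite big_split /= sumr_const.
  by rewrite big_split /= sumr_const sumrMnl !mulr_natl mulr2n.
rewrite expr2 mulr_suml mulr_sumr ler_sum // => i _.
rewrite !mulr_sumr ler_sum // => j _.
rewrite mulr_natl -subr_ge0 addrAC -sqrrB real_exprn_even_ge0 //.
by rewrite realB ?ger0_real.
Qed.

Section Exponential.
Variable R : realType.
Implicit Types (s t : R) (m n : int) (q : nat).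

Lemma expiD s t : expi (s + t) = expi s * expi t.
Proof. by rewrite /expi cosD sinD; simpc; rewrite (addrC (sin s * _)). Qed.

Lemma expiN t : expi (- t) = (expi t)^*.
Proof. by rewrite /expi cosN sinN. Qed.

Lemma norm_expi t : `|expi t| = 1.
Proof. by rewrite normc_def /= cos2Dsin2 sqrtr1. Qed.

Lemma expi_2pi_int m : expi (2 * pi * m%:~R : R) = 1.
Proof.
have expi_nat k : expi (2 * pi * k%:R : R) = 1.
  elim: k => [|k IHk]; first by rewrite mulr0 /expi cos0 sin0.
  rewrite -[k.+1]addn1 (natrD _ k 1) (mulrDr (2 * pi)) expiD IHk.
  rewrite mulr1 mul1r mulr_natl.
  by rewrite /expi cos2pi sin2pi.
case: m => k; first exact: expi_nat.
by rewrite NegzE mulrNz mulrN expiN -pmulrn expi_nat conjC1.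
Qed.

(** If [m = a * q + n], the [k]-th summands differ by the factor [expi (2 * pi * (k * a))], which is
    1. *)
Lemma ramanujan_sum_periodic q m n :
  (0 < q)%N -> (q%:Z %| m - n)%Z -> ramanujan_sum R q m = ramanujan_sum R q n.
Proof.
move=> q_gt0 /dvdzP[a /eqP]; rewrite subr_eq => /eqP ->.
apply: eq_bigr => k _; rewrite -[RHS]mul1r -(expi_2pi_int (k%:Z * a)) -expiD.
congr expi; rewrite !rmorphD !rmorphM /= -!pmulrn.
have q_neq0 : q%:R != 0 :> R by rewrite pnatr_eq0 -lt0n.
by rewrite mulrDr mulrDl !mulrA mulfK.
Qed.

Lemma ramanujan_sumN q m : ramanujan_sum R q (- m) = (ramanujan_sum R q m)^*.
Proof.
rewrite rmorph_sum; apply: eq_bigr => k _.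
by rewrite rmorphN /= mulrN mulNr expiN.
Qed.

Lemma norm_ramanujan_sum_le q m :
  (0 < q)%N -> `|ramanujan_sum R q m| <= (totient q)%:R.
Proof.
move=> q_gt0; apply: le_trans (ler_norm_sum _ _ _) _.
under eq_bigr do rewrite norm_expi.
rewrite big_mkcond /= totient_count_coprime natr_sum.
(* The totient counts residues from 0 to [q - 1], the Ramanujan sum runs from 1 to [q]: the end
   terms 0 and [q] match, both having gcd [q] with [q]. *)
rewrite big_nat_recr //= [leRHS]big_ltn // /coprime gcdn0 gcdnn addrC.
under eq_bigr => k _ do rewrite gcdnC.
by rewrite lerD ?ler_sum // => [|k _]; case: (_ == _).
Qed.

Lemma ramanujan_sum1 m : ramanujan_sum R 1 m = 1.
Proof.
rewrite /ramanujan_sum big_mkcond big_nat1 /= divr1 mulr1.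
exact: expi_2pi_int.
Qed.

End Exponential.

Section Frames.
Variables (R : realType) (N : nat).
Implicit Types (x y z : signal R N) (C D : {set Zmod N}).

Lemma inner_self x : inner x x = \sum_n `|x n| ^+ 2.
Proof. by apply: eq_bigr => n _; rewrite normCK. Qed.

Lemma innerBl x y z : inner (x - y) z = inner x z - inner y z.
Proof.
by rewrite /inner -sumrB; apply: eq_bigr => n _; rewrite !ffunE mulrBl.
Qed.

Lemma norm_inner_supported_le D (b : R[i]) z (f : signal R N) :
  supported_on D z -> (forall n, `|f n| <= b) ->
  `|inner z f| ^+ 2 <= #|D|%:R * b ^+ 2 * inner z z.
Proof.
move=> zD f_le.
have b_ge0 : 0 <= b by apply: le_trans (f_le ord0).
(* Cutting sums down to [D] is what makes the size of the support, rather than [N], appear in the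
   bound. *)
have restrict (g : Zmod N -> R[i]) :
    (forall n, z n = 0 -> g n = 0) -> \sum_n g n = \sum_(n in D) g n.
  move=> g0; rewrite [RHS]big_mkcond; apply: eq_bigr => n _.
  by case: ifP => // /negbT /zD /g0.
have inner_le : `|inner z f| <= b * \sum_(n in D) `|z n|.
  rewrite -restrict => [|n ->]; last by rewrite normr0.
  rewrite mulr_sumr; apply: le_trans (ler_norm_sum _ _ _) _.
  by apply: ler_sum => n _; rewrite normrM norm_conjC mulrC ler_wpM2r.
rewrite inner_self restrict => [|n ->]; last by rewrite normr0 expr0n.
apply: (@le_trans _ _ ((b * \sum_(n in D) `|z n|) ^+ 2)).
  by rewrite lerXn2r ?nnegrE ?mulr_ge0 ?sumr_ge0.
rewrite exprMn [#|D|%:R * _]mulrC -[leRHS]mulrA ler_wpM2l ?exprn_ge0 //.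
exact: sqr_sum_le_card.
Qed.

(** The left side pairs the partial frame operator at [z] with [z]; if that operator kills [z],
    every coefficient indexed by [J] vanishes. *)
Lemma inner_sum_self (I : finType) (J : {set I}) (f : I -> signal R N) z :
  \sum_n (\sum_(j in J) inner z (f j) * f j n) * (z n)^* =
  \sum_(j in J) `|inner z (f j)| ^+ 2.
Proof.
under eq_bigr => n _ do rewrite mulr_suml.
rewrite exchange_big; apply: eq_bigr => j _ /=.
rewrite normCK {3}/inner rmorph_sum mulr_sumr; apply: eq_bigr => n _.
by rewrite rmorphM /= conjCK -mulrA [f j n * _]mulrC.
Qed.

Lemma tight_frame_injective_on_supported (I : finType) (J : {set I})
    (f : I -> signal R N) (A : R) D (b : R[i]) z :
  tight_frame f A -> (forall j n, `|f j n| <= b) ->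
  supported_on D z -> #|~: J|%:R * #|D|%:R * b ^+ 2 < A%:C%C ->
  (forall n, \sum_(j in J) inner z (f j) * f j n = 0) -> z = 0.
Proof.
move=> [A_gt0 frame_f] f_le zD lt_A Jz0.
have J0 : \sum_(j in J) `|inner z (f j)| ^+ 2 = 0.
  by rewrite -inner_sum_self big1 // => n _; rewrite Jz0 mul0r.
have energy_ge0 n : true -> 0 <= `|z n| ^+ 2 by move=> _; apply: exprn_ge0.
have le_A : A%:C%C * inner z z <= #|~: J|%:R * #|D|%:R * b ^+ 2 * inner z z.
  rewrite -frame_f (bigID [in J]) /= J0 add0r.
  apply: (@le_trans _ _ (\sum_(j in ~: J) #|D|%:R * b ^+ 2 * inner z z)).
    rewrite [leRHS](eq_bigl (fun j => j \notin J)) => [|j]; last by rewrite inE.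
    by apply: ler_sum => j _; apply: norm_inner_supported_le.
  by rewrite sumr_const -[leLHS]mulr_natl !mulrA.
have zz_ge0 : 0 <= inner z z by rewrite inner_self sumr_ge0.
have /eqP : inner z z = 0.
  apply/eqP; apply: contraTT le_A => zz_neq0.
  by rewrite lt_geF // ltr_pM2r // lt0r zz_neq0.
rewrite inner_self psumr_eq0 // => /allP z0; apply/ffunP => n; rewrite ffunE.
by have := z0 n (mem_index_enum n); rewrite sqrf_eq0 normr_eq0 => /eqP.
Qed.

(** Samples of the convolution are frame coefficients because conjugating a Ramanujan sum negates
    its argument. *)
Lemma conv_ramanujan (q : nat) x (m : Zmod N) :
  (0 < N)%N -> (q %| N)%N ->
  conv x (ramanujan_signal R N q) m =
  inner x (shift m (ramanujan_signal R N q)).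
Proof.
move=> N_gt0 q_dv_N; rewrite ffunE; apply: eq_bigr => n _.
rewrite !ffunE -ramanujan_sumN; congr (_ * _).
apply: ramanujan_sum_periodic; first exact: dvdn_gt0 q_dv_N.
rewrite opprK -PoszD; apply: dvdn_trans q_dv_N _.
(* The representatives of [m - n] and [n - m] need not be opposite integers, but their sum is 0
   modulo [N]. *)
rewrite -{1}(prednK N_gt0) /dvdn.
have mn0 : (m - n) + (n - m) = 0 by rewrite addrA subrK subrr.
by have /= -> := congr1 val mn0.
Qed.

Variables (p d K : nat) (q : 'I_K -> nat) (A : R).

Lemma partial_reconstructionE (J : {set 'I_d * 'I_K}) x n :
  (0 < N)%N -> (forall i, q i %| N)%N ->
  partial_reconstruction p q A J x n =
  A%:C%C^-1 * \sum_(j in J) inner x (ramanujan_family R N p q j)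
                           * ramanujan_family R N p q j n.
Proof.
move=> N_gt0 q_dv_N; rewrite ffunE; congr (_ * _).
by apply: eq_bigr => j _; rewrite conv_ramanujan.
Qed.

Lemma ramanujan_frame_bound_ge (i1 : 'I_K) :
  (0 < N)%N -> q i1 = 1%N ->
  tight_frame (ramanujan_family R N p q : 'I_d * 'I_K -> signal R N) A ->
  (N * d)%:R <= A%:C%C.
Proof.
pose u : signal R N := [ffun=> 1].
move=> N_gt0 qi1 [_ /(_ u)]; have -> : inner u u = N%:R.
  rewrite inner_self; under eq_bigr => n _ do rewrite ffunE normr1 expr1n.
  by rewrite sumr_const card_ord prednK.
move=> frame1; rewrite -(@ler_pM2r _ N%:R) ?ltr0n // -frame1.
pose g (ki : 'I_d * 'I_K) := (ki.2 == i1).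
(* Only the [d] shifts of the constant signal for the divisor 1 are kept; each contributes
   [N ^ 2]. *)
rewrite (bigID g) /= ler_wpDr ?sumr_ge0 // => [j _|]; first exact: exprn_ge0.
have -> : \sum_(j | g j) `|inner u (ramanujan_family R N p q j)| ^+ 2
        = \sum_(j | g j) N%:R ^+ 2.
  apply: eq_bigr => j /eqP j2; congr (_ ^+ 2).
  rewrite /inner; under eq_bigr => n _.
    rewrite !ffunE j2 qi1 ramanujan_sum1 conjC1 mulr1; over.
  by rewrite sumr_const card_ord prednK // normr_nat.
rewrite sumr_const.
have -> : #|g| = d.
  have -> : #|g| = #|[predX predT & pred1 i1] : {pred 'I_d * 'I_K}|.
    by apply: eq_card.
  by rewrite cardX card1 muln1 card_ord.
by rewrite -[leRHS]mulr_natr natrM mulrAC expr2.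
Qed.

End Frames.

Theorem theorem3p2 (R : realType) (N p d K : nat) (q : 'I_K -> nat) (A : R)
    (C : {set Zmod N}) (J : {set 'I_d * 'I_K}) (x : signal R N) :
  (0 < p)%N -> (0 < d)%N -> N = (p * d)%N ->
  enumerates_divisors N q ->
  tight_frame (ramanujan_family R N p q : 'I_d * 'I_K -> signal R N) A ->
  supported_on C x ->
  (2 * #|~: J| * #|C|)%:R < p%:R * (d%:R / (totient N)%:R) ^+ 2 :> R ->
  uniquely_recoverable (partial_reconstruction p q A J)
    (sparse #|C|) x.
Proof.
move=> p_gt0 d_gt0 defN [_ q_div] frame_q xC lt_bound.
have N_gt0 : (0 < N)%N by rewrite defN muln_gt0 p_gt0.
have q_dv_N i : (q i %| N)%N
  by have /andP[] := (q_div (q i)).2 (ex_intro _ i erefl).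
have [i1 qi1] : exists i, q i = 1%N by apply/q_div; rewrite dvd1n.
(* The hypothesis with denominators cleared, as [N * d = p * d ^ 2]; the factor 2 accounts for the
   supports of two competing signals. *)
have lt_nat : (#|~: J| * (#|C| + #|C|) * totient N ^ 2 < N * d)%N.
  have phi_gt0 : 0 < (totient N)%:R :> R by rewrite ltr0n totient_gt0.
  move: lt_bound; rewrite exprMn exprVn mulrA ltr_pdivlMr ?exprn_gt0 //.
  rewrite -!natrX -!natrM ltr_nat => lt_pdd.
  by rewrite [in ltnRHS]defN -(mulnA p) addnn -mul2n mulnCA mulnA.
split=> [|y [[D [D_le yD]] eqT]]; first by split=> //; exists C.
apply/eqP; rewrite -subr_eq0; apply/eqP.
(* The competitor [y] has its own support [D], so [x - y] lives on the union; [totient N] bounds all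
   the Ramanujan signals at once. *)
apply: (tight_frame_injective_on_supported (J := J) (D := C :|: D)
          (b := (totient N)%:R) frame_q).
- move=> j n; rewrite !ffunE; have q_gt0 := dvdn_gt0 N_gt0 (q_dv_N j.2).
  apply: le_trans (norm_ramanujan_sum_le _ _ q_gt0) _.
  by rewrite ler_nat totient_dvd_leq.
- move=> n; rewrite inE negb_or => /andP[nC nD].
  by rewrite !ffunE xC // yD // subr0.
- apply: lt_le_trans (ramanujan_frame_bound_ge N_gt0 qi1 frame_q).
  rewrite -natrX -!natrM ltr_nat; apply: leq_ltn_trans lt_nat.
  rewrite leq_mul2r leq_mul2l.
  by rewrite (leq_trans (leq_card_setU _ _)) ?orbT // leq_add2l.
(* Cancelling the factor [1 / A] turns equality of the reconstructions into the vanishing of the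
   partial frame sum of [x - y]. *)
have A_neq0 : A%:C%C^-1 != 0.
  by rewrite invr_neq0 // gt_eqF // ltcR; case: frame_q.
move=> n; under eq_bigr => j _ do rewrite innerBl mulrBl.
rewrite sumrB; apply: (mulfI A_neq0); rewrite mulr0 mulrBr.
by rewrite -!partial_reconstructionE // eqT subrr.
Qed.
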